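(* Let $Z=\{z_0,\dots,z_{n-1}\}$ be a finite metric space and let $X=\{z_0,\dots,z_{\ell-1}\}\subseteq Z$ with $1\le \ell\le n$. Let $m^{D}((\infty,b))$, for $b>0$, be the multiplicities on the infinity line of the matching diagram of $X\subseteq Z$, and let $\eta_f=\max\{\,b\ge 0 \mid b=0 \text{ or } (b>0 \text{ and } m^{D}((\infty,b))>0)\,\}$. Then for every fixed $r\ge 0$ there are exactly $\sum_{b>r} m^{D}((\infty,b))$ connected components of $\mathrm{VR}_r(Z)$ that contain no points of $X$. In particular, for all $r\ge\eta_f$, every connected component of $\mathrm{VR}_r(Z)$ contains points of $X$. Besides, if $\eta_f=0$ then $X=Z$.
   Context: For a finite metric space $M$ with metric $d$ and $r\ge 0$, $\mathrm{VR}_r(M)$ is the graph with vertex set $M$ and an edge between distinct $x,y\in M$ whenever $d(x,y)\le r$; $X$ carries the metric restricted from $Z$. $H_0(\mathrm{VR}_r(M))$ is the $\mathbb{Z}_2$-vector space freely generated by the set $\pi_0(\mathrm{VR}_r(M))$ of connected components. Let $V=\mathrm{PH}_0(X)$ and $U=\mathrm{PH}_0(Z)$ be the persistence modules $V_r=H_0(\mathrm{VR}_r(X))$, $U_r=H_0(\mathrm{VR}_r(Z))$, $r\ge0$, with structure maps $\rho^V_{rs},\rho^U_{rs}$ ($r\le s$) induced by the inclusions of graphs. For $b>0$ let $\kappa_b$ be the interval module of $[0,b)$ and $\kappa_\infty$ that of $[0,\infty)$ over $\mathbb{Z}_2$. There is an isomorphism $U\simeq\big(\bigoplus_{b>0}\kappa_b^{m^U(b)}\big)\oplus\kappa_\infty$,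 which defines the multiplicities $m^U(b)\in\mathbb{Z}_{\ge0}$ (nonzero for only finitely many $b$). For $b>0$ put $\ker_b^-(U)=\bigcup_{0\le r<b}\ker(\rho^U_{0r})$ and $\ker_b^+(U)=\ker(\rho^U_{0b})$, subspaces of $U_0$; define $\ker_a^\pm(V)\subseteq V_0$ in the same way. Since $X\subseteq Z$, we view $V_0\subseteq U_0$. The induced block function is, for $a,b>0$, $$\mathcal{M}_X^Z(a,b)=\dim\left(\frac{\ker_a^+(V)\cap\ker_b^+(U)}{\ker_a^-(V)\cap\ker_b^+(U)+\ker_a^+(V)\cap\ker_b^-(U)}\right).$$ The matching diagram $D=D(X,Z)$ is the multiset of pairs with multiplicities $m^D((a,b))=\mathcal{M}_X^Z(a,b)$ for $a,b\in\mathbb{R}_{>0}$, and $m^D((\infty,b))=m^U(b)-\sum_{a<\infty}\mathcal{M}_X^Z(a,b)$ for $b>0$. *)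

(* Defs.v *)
From HB Require Import structures.
From mathcomp Require Import all_boot all_order all_algebra finmap.
From mathcomp Require Import all_classical reals constructive_ereal topology.

Set Implicit Arguments.
Unset Strict Implicit.
Unset Printing Implicit Defensive.

Import Order.TTheory GRing.Theory Num.Theory.

Local Open Scope ring_scope.

Section H0.
Implicit Types T : finType.

Definition pi0 T (e : rel T) : {set {set T}} :=
  [set [set y | connect e x y] | x : T]%SET.

Notation pi0_type e := {C : {set _} | C \in pi0 e}.

Definition H0 T (e : rel T) : vectType 'F_2 := {ffun pi0_type e -> ('F_2)^o}.

(* For a graph morphism [f], each component [C] of the source has its image in
   exactly one component [C'] of the target, and [C] is sent to [C']. *)
Definition H0_fun T1 T2 (e1 : rel T1) (e2 : rel T2) (f : T1 -> T2)
    (v : H0 e1) : H0 e2 :=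
  [ffun C' : pi0_type e2 =>
     \sum_(C : pi0_type e1 | (f @: val C \subset val C')%SET) v C].

Definition H0_map T1 T2 (e1 : rel T1) (e2 : rel T2) (f : T1 -> T2) :
  'Hom(H0 e1, H0 e2) := linfun (@H0_fun T1 T2 e1 e2 f).

Lemma H0_fun_linear T1 T2 (e1 : rel T1) (e2 : rel T2) (f : T1 -> T2) :
  linear (@H0_fun T1 T2 e1 e2 f).
Proof.
move=> a u v; apply/ffunP => C'; rewrite !ffunE scaler_sumr -big_split /=.
by apply: eq_bigr => C _; rewrite !ffunE.
Qed.

HB.instance Definition _ T1 T2 (e1 : rel T1) (e2 : rel T2) (f : T1 -> T2) :=
  GRing.isLinear.Build 'F_2 (H0 e1) (H0 e2) _ (@H0_fun T1 T2 e1 e2 f)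
    (@H0_fun_linear T1 T2 e1 e2 f).

Lemma H0_mapE T1 T2 (e1 : rel T1) (e2 : rel T2) (f : T1 -> T2) v :
  @H0_map T1 T2 e1 e2 f v = H0_fun e2 f v.
Proof. by rewrite lfunE. Qed.

Lemma pi0_eq T (e : rel T) (C : pi0_type e) x : symmetric e ->
  x \in val C -> val C = [set y | connect e x y]%SET.
Proof.
move=> es; case: C => C /= /imsetP[z _ ->]; rewrite inE => zx.
by apply/setP => y; rewrite !inE (same_connect (sym_connect_sym es) zx).
Qed.

Lemma pi0_neq0 T (e : rel T) (C : pi0_type e) : exists x, x \in val C.
Proof. by case: C => C /= /imsetP[z _ ->]; exists z; rewrite inE. Qed.

Lemma H0_map_id T (e : rel T) : symmetric e ->
  @H0_map T T e e id = \1%VF.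
Proof.
move=> es; apply/lfunP => v; rewrite H0_mapE id_lfunE; apply/ffunP => C'.
rewrite ffunE (big_pred1 C') // => C /=; rewrite imset_id; apply/idP/eqP.
  move=> /fintype.subsetP sub; have [x xC] := pi0_neq0 C; apply: val_inj.
  by rewrite (pi0_eq es xC) (pi0_eq es (sub _ xC)).
by move=> ->.
Qed.

Lemma H0_map_comp T1 T2 T3 (e1 : rel T1) (e2 : rel T2) (e3 : rel T3)
    (f : T1 -> T2) (g : T2 -> T3) : symmetric e1 -> symmetric e2 ->
  {homo f : x y / e1 x y >-> e2 x y} -> {homo g : x y / e2 x y >-> e3 x y} ->
  (@H0_map T2 T3 e2 e3 g \o @H0_map T1 T2 e1 e2 f)%VF =
  @H0_map T1 T3 e1 e3 (g \o f).
Proof.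
have homC (S1 S2 : finType) (r1 : rel S1) (r2 : rel S2) (h : S1 -> S2) :
    {homo h : x y / r1 x y >-> r2 x y} ->
    {homo h : x y / connect r1 x y >-> connect r2 x y}.
  move=> hh x y /connectP[p pp ->]; apply/connectP; exists (map h p).
    by apply: homo_path pp => ? ?; apply: hh.
  by rewrite last_map.
move=> s1 s2 fh gh; apply/lfunP => v; rewrite comp_lfunE !H0_mapE.
apply/ffunP => C3; rewrite !ffunE.
under eq_bigr do rewrite ffunE.
rewrite (exchange_big_dep predT) //= (big_mkcond (fun C => _ \subset _)) /=.
apply: eq_bigr => C _; have [x xC] := pi0_neq0 C.
have C2P : [set y | connect e2 (f x) y]%SET \in pi0 e2 by apply: imset_f.
pose C2 : pi0_type e2 := exist (fun D => D \in pi0 e2) _ C2P.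
have fC2 : (f @: val C \subset val C2)%SET.
  apply/fintype.subsetP => _ /imsetP[y yC ->]; rewrite inE; apply: (homC _ _ _ _ _ fh).
  by move: yC; rewrite (pi0_eq s1 xC) inE.
have C2u (C' : pi0_type e2) : (f @: val C \subset val C')%SET = (C' == C2).
  apply/idP/eqP => [/fintype.subsetP sub|->//]; apply: val_inj.
  by rewrite (pi0_eq s2 (sub _ (imset_f f xC))).
have sub3 : (g @: val C2 \subset val C3)%SET =
            ((g \o f) @: val C \subset val C3)%SET.
  apply/idP/idP => /fintype.subsetP sub; apply/fintype.subsetP => _ /imsetP[y yC ->].
    by apply: sub => /=; apply: imset_f; move/fintype.subsetP: fC2; apply; apply: imset_f.
  have gfx : (g \o f) x \in val C3 by apply: sub; apply: imset_f.
  move: gfx; case: (C3) => D /= /imsetP[z _ ->]; rewrite !inE => zx.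
  by apply: connect_trans zx _; apply: (homC _ _ _ _ _ gh); move: yC; rewrite inE.
rewrite -sub3; case: ifP => gC2.
  rewrite (big_pred1 C2) // => C' /=; rewrite C2u.
  by case: eqP => [->|_]; rewrite ?andbF // gC2.
rewrite big1 // => C' /andP[gC']; rewrite C2u => /eqP C'E.
by rewrite C'E gC2 in gC'.
Qed.

End H0.

(* Persistence modules over F_2 indexed by [0, +oo).  The data is total on [R];
   only its part at indices [>= 0] is constrained or used. *)
Record persistence_module (R : realType) := PersistenceModule {
  pm_space :> R -> vectType 'F_2;
  pm_map : forall r s, 'Hom(pm_space r, pm_space s);
  pm_map_id : forall r, 0 <= r -> pm_map r r = \1%VF;
  pm_map_comp : forall r s t, 0 <= r -> r <= s -> s <= t ->
    (pm_map s t \o pm_map r s)%VF = pm_map r t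
}.

Definition pm_iso (R : realType) (V W : persistence_module R) : Prop :=
  exists phi : forall r, 'Hom(V r, W r),
    (forall r, 0 <= r -> bijective (phi r)) /\
    (forall r s, 0 <= r -> r <= s ->
       (phi s \o pm_map V r s)%VF = (pm_map W r s \o phi r)%VF).

Section Modules.
Variable R : realType.
Implicit Types V W : persistence_module R.

Definition zero_module : persistence_module R.
Proof.
refine (@PersistenceModule R (fun=> 'rV['F_2]_0) (fun _ _ => \1%VF) _ _) => //.
by move=> *; rewrite comp_lfun1l.
Defined.

Definition dsum_fun V W r s (x : V r * W r) : V s * W s :=
  (pm_map V r s x.1, pm_map W r s x.2).

Lemma dsum_fun_linear V W r s : linear (@dsum_fun V W r s).
Proof. by move=> a [u1 u2] [v1 v2]; rewrite /dsum_fun /= !linearP. Qed.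

HB.instance Definition _ V W r s :=
  GRing.isLinear.Build 'F_2 (V r * W r)%type (V s * W s)%type _
    (@dsum_fun V W r s) (@dsum_fun_linear V W r s).

Definition dsum_module V W : persistence_module R.
Proof.
refine (@PersistenceModule R (fun r => (V r * W r)%type)
  (fun r s => linfun (@dsum_fun V W r s)) _ _).
- move=> r r0; apply/lfunP => -[x y].
  by rewrite lfunE id_lfunE /= /dsum_fun /= !pm_map_id // !id_lfunE.
- move=> r s t r0 rs st; apply/lfunP => -[x y].
  rewrite comp_lfunE !lfunE /= /dsum_fun /=.
  by rewrite -(pm_map_comp V r0 rs st) -(pm_map_comp W r0 rs st) !comp_lfunE.
Defined.

(* The interval module of [0, b), for [b] in (0, +oo]: at [r] it is ['rV_1] if
   [r < b] and ['rV_0] otherwise (a boolean is read as a number in {0, 1}), and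
   the map from [r] to [s] is the identity matrix when both are ['rV_1]. *)
Definition interval_map (b : \bar R) (r s : R) :
    'Hom('rV['F_2]_(r%:E < b)%E, 'rV['F_2]_(s%:E < b)%E) :=
  linfun (mulmxr (pid_mx 1 : 'M_((r%:E < b)%E, (s%:E < b)%E))).

Definition interval_module (b : \bar R) : persistence_module R.
Proof.
refine (@PersistenceModule R (fun r => 'rV['F_2]_(r%:E < b)%E)
  (interval_map b) _ _).
- move=> r _; apply/lfunP => x; rewrite lfunE id_lfunE /=.
  case: (r%:E < b)%E x => x; last by rewrite !thinmx0.
  by rewrite pid_mx_1 mulmx1.
- move=> r s t _ rs st; apply/lfunP => x; rewrite comp_lfunE !lfunE /= -mulmxA.
  rewrite mul_pid_mx; congr (_ *m _).
  have : (t%:E < b)%E -> (s%:E < b)%E by apply: le_lt_trans; rewrite lee_fin.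
  case: (t%:E < b)%E => [->//|_].
  by apply/matrixP => i [].
Defined.

(* [m b] is the multiplicity of the interval module of [0, b). *)
Definition is_barcode V (m : {fsfun R -> nat with 0%N}) : Prop :=
  (forall b, b \in finsupp m -> 0 < b) /\
  pm_iso V
    (dsum_module
       (\big[dsum_module/zero_module]_(b <- finsupp m)
          \big[dsum_module/zero_module]_(i < m b) interval_module b%:E)
       (interval_module +oo%E)).

(* Multiplicities of the finite intervals in the interval decomposition of [V]
   (junk if there is none). *)
Definition multiplicity V : {fsfun R -> nat with 0%N} :=
  xget [fsfun] [set m | is_barcode V m]%classic.

End Modules.

(* The subspace with set of elements [A] (junk if [A] is not a subspace). *)
Definition vspace_of (K : fieldType) (E : vectType K) (A : set E) : {vspace E} :=
  xget 0%VS [set W : {vspace E} | forall v, v \in W <-> A v]%classic.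

Definition ker_minus (R : realType) (V : persistence_module R) (b : R) :
    {vspace V 0} :=
  vspace_of (\bigcup_(r in [set r : R | 0 <= r < b])
               [set v | v \in lker (pm_map V 0 r)])%classic.

Definition ker_plus (R : realType) (V : persistence_module R) (b : R) :
  {vspace V 0} := lker (pm_map V 0 b).

Section VietorisRips.
Variables (R : realType) (M : metricType R).
Implicit Types A X Z : {fset M}.

(* A finite metric space is a finite subset of a metric space, with the
   restricted metric. *)
Definition VR A (r : R) : rel A :=
  fun x y => (x != y) && (mdist (val x) (val y) <= r).

Lemma VR_sym A r : symmetric (@VR A r).
Proof. by move=> x y; rewrite /VR eq_sym metric_sym. Qed.

Lemma VR_homo A r s : r <= s ->
  {homo (@id A) : x y / VR r x y >-> VR s x y}.
Proof. by move=> rs x y /andP[xy xyr]; rewrite /VR xy (le_trans xyr). Qed.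

Definition PH0 A : persistence_module R.
Proof.
refine (@PersistenceModule R (fun r => H0 (@VR A r))
  (fun r s => H0_map (@VR A r) (@VR A s) id) _ _).
- by move=> r _; apply: H0_map_id; apply: VR_sym.
- move=> r s t _ rs st.
  by rewrite (H0_map_comp (VR_sym _) (VR_sym _) (VR_homo rs) (VR_homo st)).
Defined.

(* The inclusion of V_0 = PH0 X 0 into U_0 = PH0 Z 0. *)
Definition H0_incl X Z (XZ : (X `<=` Z)%fset) : 'Hom(PH0 X 0, PH0 Z 0) :=
  H0_map (@VR X 0) (@VR Z 0) (fincl XZ).

(* The denominator is a subspace of the numerator, so the dimension of the
   quotient is the difference of the dimensions. *)
Definition block_function X Z (XZ : (X `<=` Z)%fset) (a b : R) : nat :=
  let Va_plus := (H0_incl XZ @: ker_plus (PH0 X) a)%VS in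
  let Va_minus := (H0_incl XZ @: ker_minus (PH0 X) a)%VS in
  let Ub_plus := ker_plus (PH0 Z) b in
  let Ub_minus := ker_minus (PH0 Z) b in
  (\dim (Va_plus :&: Ub_plus) -
   \dim (Va_minus :&: Ub_plus + Va_plus :&: Ub_minus))%N.

(* The sum over all [a > 0] is the one of [fsbigop]: only finitely many terms
   are nonzero.  The difference is taken in [int], hence not truncated. *)
Definition mD_infty X Z (XZ : (X `<=` Z)%fset) (b : R) : int :=
  (multiplicity (PH0 Z) b)%:Z -
  \sum_(a \in [set a : R | 0 < a]%classic) (block_function XZ a b)%:Z.

(* The maximum of [S]: the element of [S] that is an upper bound of [S]. *)
Definition eta_f X Z (XZ : (X `<=` Z)%fset) : R :=
  let S := [set b : R | 0 <= b /\ (b = 0 \/ 0 < b /\ 0 < mD_infty XZ b)]%classic in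
  xget 0 (S `&` ubound S)%classic.

End VietorisRips.

(* Main.v *)
(* Write c(r) for the number of components of VR_r(Z), and c_X(r) for the number
   of those that meet X.  All structure maps out of U_0 are surjective, so the
   module U is determined up to isomorphism by the dimensions c(r) (a basis of
   U_0 adapted to the flag of kernels gives the isomorphism with a sum of
   interval modules); hence m^U(b) = c(b^-) - c(b).

   For fixed b, the sum over a of M(a, b) telescopes along the flag
   ker_a^+(V) to
     [dim (W :&: ker_b^+ U) - dim (W :&: ker_b^- U)],
   where W is the kernel of V_0 -> V_t for t large.  Both intersections are
   unchanged if W is replaced by V_0, because at scale t all points are
   connected, and rank-nullity for V_0 -> U_b turns the difference into
   c_X(b^-) - c_X(b).
   So m^D(oo, b) = f(b^-) - f(b) with f := c - c_X the number of components
   missing X, and summing over b > r telescopes to f(r), since f vanishes for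
   large r. *)
From HB Require Import structures.
Require Import Defs.
From mathcomp Require Import all_boot all_order all_algebra finmap zify.
From mathcomp Require Import all_classical reals constructive_ereal topology.
Set Implicit Arguments.
Unset Strict Implicit.
Unset Printing Implicit Defensive.
Import Order.TTheory GRing.Theory Num.Theory.
Local Open Scope ring_scope.

(** * Chains of subspaces and bases adapted to them *)

(** A chain has at most one member of each dimension, so a basis can be grown upwards, completing it
    inside each member in turn. *)
Lemma flag_basis (K : fieldType) (E : vectType K) (P : set {vspace E}) :
  (forall U W, P U -> P W -> (U <= W)%VS || (W <= U)%VS) ->
  exists2 e : seq E, basis_of fullv e &
    forall U, P U -> <<take (\dim U) e>>%VS = U.
Proof.
move=> Ptot.
have {Ptot}Pext U W : P U \/ U = fullv -> P W \/ W = fullv ->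
    (\dim U <= \dim W)%N -> (U <= W)%VS.
  case=> [PU|->] [PW|->] leUW; rewrite ?subvf //.
    have /orP[//|WU] := Ptot _ _ PU PW.
    by have := eqEdim W U; rewrite WU leUW => /eqP ->.
  by have := eqEdim W fullv; rewrite leUW subvf => /eqP ->.
(* Induction on a bound [d]: [e] is adapted to the members of dimension below [d] and lies in all
   others. Counting [fullv] as a member makes the final [e] span [E]. *)
suff [e [fe ee _]] : exists e : seq E, [/\ free e,
    forall U, P U \/ U = fullv -> (\dim U < (\dim {:E}).+1)%N ->
      <<take (\dim U) e>>%VS = U &
    forall U, P U \/ U = fullv -> ((\dim {:E}).+1 <= \dim U)%N ->
      (<<e>> <= U)%VS].
  have eU U (PU : P U \/ U = fullv) : <<take (\dim U) e>>%VS = U.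
    by apply: (ee _ PU); rewrite ltnS dimvS ?subvf.
  exists e; last by move=> U PU; apply: eU; left.
  rewrite /basis_of fe andbT eqEsubv subvf /=.
  have /vspaceP fulle := eU _ (or_intror erefl).
  by apply/subvP => x /=; rewrite -fulle; apply/subvP/sub_span/mem_take.
elim: (_.+1) => [|d [e [fe ee eU]]].
  by exists [::]; split; rewrite ?nil_free // => U _ _; rewrite span_nil sub0v.
have [[W PW dW]|noW] := pselect (exists2 W, P W \/ W = fullv & \dim W = d).
  have eW : (<<e>> <= W)%VS by apply: eU; rewrite ?dW.
  have spanW : (<<e ++ vbasis (W :\: <<e>>)>> = W)%VS.
    by rewrite span_cat (span_basis (vbasisP _)) addvC addv_diff; apply/addv_idPl.
  have fW : free (e ++ vbasis (W :\: <<e>>)%VS).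
    rewrite cat_free fe (basis_free (vbasisP _)) /=.
    rewrite (span_basis (vbasisP _)).
    by apply/directv_addP; rewrite capvC capv_diff.
  exists (e ++ vbasis (W :\: <<e>>)%VS); split=> // U PU.
    rewrite ltnS leq_eqVlt => /orP[/eqP dU|dU].
      have -> : U = W.
        by apply/eqP; rewrite eqEsubv !Pext // dU dW.
      by rewrite take_oversize // -(eqP fW) spanW.
    (* [U] is spanned by vectors of [e], so [\dim U] is at most the size of [e] and the appended
       vectors are not reached. *)
    have := dim_span (take (\dim U) e); rewrite ee // size_take take_cat.
    case: ltnP => [_ _|leU leU']; first exact: ee.
    by rewrite (eqP leU') take0 cats0; have := ee U PU dU; rewrite take_oversize.
  by move=> dU; rewrite spanW Pext // dW ltnW.
exists e; split=> // U PU dU.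
  apply: ee => //; move: dU; rewrite ltnS leq_eqVlt => /orP[/eqP dU|//].
  by case: noW; exists U.
by apply: eU => //; apply: ltnW.
Qed.

(** An adapted basis is sent to an adapted basis: [F i] and [F' i] are spanned by initial segments
    of equal length. *)
Lemma flag_iso (K : fieldType) (E E' : vectType K) (I : Type)
    (F : I -> {vspace E}) (F' : I -> {vspace E'}) :
  (forall i j, (F i <= F j)%VS || (F j <= F i)%VS) ->
  (forall i j, (F' i <= F' j)%VS || (F' j <= F' i)%VS) ->
  (forall i, \dim (F i) = \dim (F' i)) -> \dim {:E} = \dim {:E'} ->
  exists f : 'Hom(E, E'), [/\ lker f = 0%VS, limg f = fullv &
    forall i, (f @: F i)%VS = F' i].
Proof.
move=> Ftot Ftot' dF dE.
have [|e be eF] := @flag_basis K E [set U | exists i, U = F i]%classic.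
  by move=> _ _ [i ->] [j ->].
have [|e' be' eF'] := @flag_basis K E' [set U | exists i, U = F' i]%classic.
  by move=> _ _ [i ->] [j ->].
have se : size e' = size e.
  rewrite -(size_basis (X := in_tuple e) be) -(size_basis (X := in_tuple e') be').
  by rewrite dE.
have [f0 f0P] := linear_of_free e e'.
have {f0P}mapf : map (linfun f0) e = e'.
  rewrite -f0P ?(basis_free be) //; apply: eq_map => x; exact: lfunE.
have limgf : limg (linfun f0) = fullv.
  by rewrite -(span_basis be) limg_span mapf (span_basis be').
exists (linfun f0); split=> // [|i].
  apply/eqP; rewrite -dimv_eq0 -(eqn_add2r (\dim (limg (linfun f0)))) add0n.
  by have := limg_ker_dim (linfun f0) fullv; rewrite capfv => ->; rewrite limgf dE.
rewrite -(eF (F i)); last by exists i.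
rewrite -(eF' (F' i)); last by exists i.
by rewrite limg_span map_take mapf dF.
Qed.

(** * Modules generated at index 0 and their classification by dimensions *)

Section ModuleIso.
Variable R : realType.
Implicit Types V W : persistence_module R.

(** Up to isomorphism, such a module is the family of quotients of [V 0] by an increasing family of
    kernels. *)
Definition generated_at_0 V := forall r : R, 0 <= r -> limg (pm_map V 0 r) = fullv.

Lemma generated_at_0P V (r : R) (v : V r) : generated_at_0 V -> 0 <= r ->
  exists u, v = pm_map V 0 r u.
Proof.
move=> gV r0; have := memvf v; rewrite -(gV r r0) => /memv_imgP[u _ ->].
by exists u.
Qed.

Lemma lker_pm_map V (r s : R) : 0 <= r -> r <= s ->
  (lker (pm_map V 0 r) <= lker (pm_map V 0 s))%VS.
Proof.
move=> r0 rs; apply/subvP => v vr; rewrite memv_ker.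
move: vr; rewrite memv_ker => /eqP v0.
by rewrite -(pm_map_comp V (lexx 0) r0 rs) comp_lfunE v0 linear0.
Qed.

(** By rank-nullity the kernels in [V 0] and [W 0] have equal dimensions, so [flag_iso] matches the
    two chains, and its isomorphism descends to the quotients. *)
Lemma pm_iso_generated V W : generated_at_0 V -> generated_at_0 W ->
  (forall r : R, 0 <= r -> \dim {:V r} = \dim {:W r}) -> pm_iso V W.
Proof.
move=> gV gW dVW.
have ktot (U : persistence_module R) (i j : {r : R | 0 <= r}) :
    (lker (pm_map U 0 (val i)) <= lker (pm_map U 0 (val j)))%VS ||
    (lker (pm_map U 0 (val j)) <= lker (pm_map U 0 (val i)))%VS.
  have /orP[ij|ji] := le_total (val i) (val j).
    by apply/orP; left; apply: lker_pm_map ij; exact: valP.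
  by apply/orP; right; apply: lker_pm_map ji; exact: valP.
have kdim (U : persistence_module R) (r : R) : generated_at_0 U -> 0 <= r ->
    (\dim (lker (pm_map U 0 r)) + \dim {:U r} = \dim {:U 0%R})%N.
  move=> gU r0; rewrite -(limg_ker_dim (pm_map U 0 r) fullv) capfv.
  by rewrite gU.
have [i||f [kf lf fk]] := flag_iso (ktot V) (ktot W).
- apply: (@addIn (\dim {:V (val i)})); rewrite (kdim V _ gV (valP i)).
  by rewrite (dVW _ (valP i)) (kdim W _ gW (valP i)); apply: dVW.
- exact: dVW.
have inj_f : injective f by apply/lker0P/eqP.
have fk0 (r : R) v : 0 <= r -> (pm_map W 0 r (f v) == 0) = (pm_map V 0 r v == 0).
  move=> r0; rewrite -!memv_ker -(fk (exist _ r r0)) /=.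
  apply/memv_imgP/idP => [[u uk /eqP]|vk]; last by exists v.
  by rewrite (inj_eq inj_f) => /eqP ->.
have [phi phiE] : exists phi : forall r, 'Hom(V r, W r),
    forall r u, 0 <= r -> phi r (pm_map V 0 r u) = pm_map W 0 r (f u).
  (* Lift to [V 0], apply [f], project. Two lifts differ by a kernel element, so the chosen lift
     does not matter. *)
  exists (fun r => pm_map W 0 r \o f \o (pm_map V 0 r)^-1)%VF => r u r0.
  apply/eqP; rewrite -subr_eq0 !comp_lfunE -!linearB fk0 // linearB.
  by rewrite subr_eq0; apply/eqP/limg_lfunVK/memv_img/memvf.
exists phi; split=> [r r0|r s r0 rs].
  have inj : injective (phi r).
    apply/lker0P; rewrite -subv0; apply/subvP => v; rewrite memv_ker memv0.
    by have [u ->] := generated_at_0P v gV r0; rewrite phiE // fk0.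
  exists (phi r)^-1%VF; first exact/lker0_lfunK/lker0P.
  move=> w; apply: limg_lfunVK.
  have [u ->] := generated_at_0P w gW r0.
  have := memvf u; rewrite -lf => /memv_imgP[v _ ->].
  by rewrite -phiE // memv_img ?memvf.
apply/lfunP => v; have [u ->] := generated_at_0P v gV r0.
rewrite !comp_lfunE phiE // -(comp_lfunE (pm_map V r s)).
rewrite (pm_map_comp V (lexx 0) r0 rs).
by rewrite phiE ?(le_trans r0) // -(comp_lfunE (pm_map W r s))
  (pm_map_comp W (lexx 0) r0 rs).
Qed.

Lemma pm_iso_dim V W (r : R) : pm_iso V W -> 0 <= r -> \dim {:V r} = \dim {:W r}.
Proof.
move=> [phi [bphi _]] r0; have [g fg gf] := bphi r r0.
have kphi : lker (phi r) = 0%VS by apply/eqP/lker0P/(can_inj fg).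
rewrite -(limg_ker_dim (phi r) fullv) kphi capv0 dimv0 add0n; congr (\dim _).
apply/vspaceP => w; rewrite memvf; apply/memv_imgP; exists (g w) => //.
exact: memvf.
Qed.

Lemma dim_dsum_module V W (r : R) :
  \dim {:dsum_module V W r} = (\dim {:V r} + \dim {:W r})%N.
Proof. by rewrite !dimvf. Qed.

Lemma dim_zero_module (r : R) : \dim {:@zero_module R r} = 0%N.
Proof. by rewrite dimvf; apply: etrans (dim_matrix _ _ _) (mul1n _). Qed.

Lemma dim_interval_module (b : \bar R) (r : R) :
  \dim {:interval_module b r} = (r%:E < b)%E.
Proof. by rewrite dimvf; apply: etrans (dim_matrix _ _ _) (mul1n _). Qed.

Lemma generated_dsum V W : generated_at_0 V -> generated_at_0 W ->
  generated_at_0 (dsum_module V W).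
Proof.
move=> gV gW r r0; apply/vspaceP => -[v w]; rewrite memvf; apply/memv_imgP.
have [[v' ->] [w' ->]] := (generated_at_0P v gV r0, generated_at_0P w gW r0).
by exists (v', w'); rewrite ?memvf //= lfunE.
Qed.

Lemma generated_zero : generated_at_0 (@zero_module R).
Proof. by move=> r r0; apply: lim1g. Qed.

Lemma generated_interval (b : \bar R) : generated_at_0 (interval_module b).
Proof.
move=> r r0; apply/vspaceP => w; rewrite memvf; apply/memv_imgP => /=.
suff wE : forall w : 'rV['F_2]_(r%:E < b)%E,
    w = interval_map b 0 r (w *m pid_mx 1).
  by exists (w *m pid_mx 1); [exact: memvf|exact: wE].
move=> {}w; rewrite lfunE /= -mulmxA mul_pid_mx.
have : (r%:E < b)%E -> (0%:E < b)%E by apply: le_lt_trans; rewrite lee_fin.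
move: w; case: (r%:E < b)%E => [w -> //|w _]; last by rewrite !thinmx0.
by rewrite pid_mx_1 mulmx1.
Qed.

(** Convertible with the model module in [is_barcode], so that what is shown here applies there
    directly. *)
Definition barcode_module (m : {fsfun R -> nat with 0%N}) :=
  dsum_module
    (\big[@dsum_module R/@zero_module R]_(b <- finsupp m)
       \big[@dsum_module R/@zero_module R]_(i < m b) interval_module b%:E)
    (interval_module +oo%E).

Lemma generated_barcode m : generated_at_0 (barcode_module m).
Proof.
apply: generated_dsum (generated_interval _).
elim/big_ind: _ => [||b _]; [exact: generated_zero|exact: generated_dsum|].
elim/big_ind: _ => [||i _]; [exact: generated_zero|exact: generated_dsum|].
exact: generated_interval.
Qed.

Lemma dim_barcode m (r : R) :
  \dim {:barcode_module m r} = (\sum_(b <- finsupp m | (r < b)%R) m b + 1)%N.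
Proof.
have dimM := big_morph (fun V => \dim {:pm_space V r})
  (fun V W => dim_dsum_module V W r) (dim_zero_module r).
rewrite dim_dsum_module dim_interval_module ltry; congr addn.
rewrite dimM [RHS]big_mkcond /=; apply: eq_bigr => b _; rewrite dimM.
under eq_bigr do rewrite dim_interval_module lte_fin.
by rewrite sum_nat_const card_ord; case: ifP; rewrite ?muln1 ?muln0.
Qed.

End ModuleIso.

(** * Step functions with jumps in a finite list, and telescoping sums of their jumps *)

Section StepFunctions.
Variables (R : realDomainType) (D : seq R).

(* The greatest element of D in (0, b), or 0 if there is none. *)
Definition below (b : R) := \big[Num.max/0]_(d <- D | d < b) d.

(* g is constant on each interval [r, s] with no element of D in (r, s]. *)
Definition step_on T (g : R -> T) := forall r s : R, 0 <= r -> r <= s ->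
  (forall d, d \in D -> r < d -> s < d) -> g r = g s.

Lemma below_ge0 b : 0 <= below b.
Proof. by rewrite /below; elim/big_rec: _ => // d x _ x0; rewrite le_max x0 orbT. Qed.

Lemma below_lt b : 0 < b -> below b < b.
Proof. by move=> b0; apply: bigmax_lt. Qed.

Lemma le_below b d : d \in D -> d < b -> d <= below b.
Proof. by move=> dD db; apply: le_bigmax_seq. Qed.

(** This makes [g (below b)] the left limit of [g] at [b]. *)
Lemma step_on_below T (g : R -> T) b r : step_on g -> below b <= r -> r < b ->
  g (below b) = g r.
Proof.
move=> gD br rb; apply: gD (below_ge0 b) br _ => d dD; rewrite ltNge => db.
by rewrite (lt_le_trans rb) // leNgt; apply: contra db; apply: le_below.
Qed.

Lemma step_on_belowN T (g : R -> T) b : step_on g -> 0 < b -> b \notin D ->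
  g (below b) = g b.
Proof.
move=> gD b0 bD; apply: gD (below_ge0 b) (ltW (below_lt b0)) _ => d dD.
rewrite ltNge => db; rewrite lt_neqAle (contraNneq _ bD) => [|->//].
by rewrite leNgt; apply: contra db; apply: le_below.
Qed.

Hypothesis D_uniq : uniq D.

(** [D] need not be sorted: the induction, on the number of elements above [r], splits off the
    smallest of them. *)
Lemma telescope_step (G : zmodType) (g : R -> G) (r t : R) : step_on g ->
  0 <= r -> 0 <= t -> (forall d, d \in D -> d <= t) ->
  \sum_(b <- D | r < b) (g (below b) - g b) = g r - g t.
Proof.
move=> gD + t0 Dt.
have [n] := ubnP (count (fun d => r < d) D); elim: n r => // n IHn r ltn r0.
have [/hasP[d0 d0D rd0]|/hasPn rD] := boolP (has (fun d => r < d) D); last first.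
  rewrite big_seq_cond big1 => [|d /andP[dD rd]]; last first.
    by rewrite (negPf (rD d dD)) in rd.
  have /orP[rt|tr] := le_total r t.
    by rewrite (gD r t) ?subrr // => d /rD /negPf ->.
  by rewrite (gD t r) ?subrr // => d /Dt dt /(le_lt_trans dt); rewrite ltxx.
have [b [bD rb minb]] : exists b, [/\ b \in D, r < b &
    forall d, d \in D -> r < d -> b <= d].
  elim: (D) d0 d0D rd0 => // x s IHs d0.
  have [/hasP[d1 d1s rd1] _ _|/hasPn rs] := boolP (has (fun d => r < d) s).
    have [b [bs rb bmin]] := IHs d1 d1s rd1.
    have [rx|xr] := ltP r x; last first.
      exists b; split; rewrite ?inE ?bs ?orbT // => d /predU1P[->|]; last exact: bmin.
      by rewrite ltNge xr.
    have [xb|bx] := leP x b.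
      exists x; split; rewrite ?inE ?eqxx // => d /predU1P[->//|ds rd].
      exact: le_trans xb (bmin _ ds rd).
    exists b; split; rewrite ?inE ?bs ?orbT // => d /predU1P[-> _|]; last exact: bmin.
    exact: ltW.
  rewrite inE => /predU1P[->|/rs /negPf -> //] rx.
  exists x; split; rewrite ?inE ?eqxx // => d /predU1P[-> //|/rs /negPf -> //].
have Dr d : d \in D -> (r < d) && (d != b) = (b < d).
  move=> dD; rewrite (lt_neqAle b) (eq_sym b) andbC.
  case: eqP => //= _; apply/idP/idP; first exact: minb.
  exact: lt_le_trans.
(* No element of [D] lies strictly between [r] and [b], so [g] is constant between [r] and
   [below b], whichever comes first. *)
have -> : g r = g (below b).
  have [br|rbel] := leP (below b) r; first by rewrite (step_on_below gD br rb).
  apply: gD (ltW rbel) _ => // d dD rd.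
  exact: lt_le_trans (below_lt (le_lt_trans r0 rb)) (minb d dD rd).
rewrite big_mkcond (bigD1_seq b) //= rb -big_mkcondr big_seq_cond.
rewrite (eq_bigl (fun d => (d \in D) && (b < d))) => [|d]; last first.
  by case dD: (d \in D); rewrite //= -(Dr d dD) andbC.
rewrite -big_seq_cond IHn ?addrA ?subrK ?(ltW (le_lt_trans r0 rb)) //.
rewrite -ltnS; apply: leq_trans ltn; rewrite ltnS -!size_filter.
apply: (@uniq_leq_size _ (b :: _)).
  by rewrite /= mem_filter ltxx filter_uniq.
move=> d; rewrite inE mem_filter => /predU1P[->|/andP[bd dD]].
  by rewrite mem_filter rb.
by rewrite mem_filter dD (lt_trans rb).
Qed.

(** The jumps vanish off [D], so the sum over all [b] above [r] reduces to one over [D]. *)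
Lemma fsum_step (G : zmodType) (g h : R -> G) (r t : R) : step_on g ->
  0 <= r -> 0 <= t -> (forall d, d \in D -> d <= t) ->
  (forall b, 0 < b -> h b = g (below b) - g b) ->
  \sum_(b \in [set b : R | r < b]%classic) h b = g r - g t.
Proof.
move=> gD r0 t0 Dt hE; rewrite -(telescope_step gD r0 t0 Dt).
rewrite (fsbigE [seq b <- D | r < b]) ?filter_uniq //=.
- rewrite big_filter_cond; apply: eq_big => [b|b /andP[rb _]].
    by rewrite mem_setE andbb.
  by rewrite hE // (le_lt_trans r0 rb).
- by move=> b /=; rewrite mem_filter => /andP[].
move=> b rb; rewrite mem_filter rb /= => bD.
by rewrite hE ?(le_lt_trans r0 rb) // (step_on_belowN gD) ?subrr ?(le_lt_trans r0 rb).
Qed.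

End StepFunctions.

(** * Ranks of the maps induced on [H0] *)

Section RankH0.

Definition ffun_restr (K : fieldType) (I : finType) (P : pred I)
    (u : {ffun I -> K^o}) : {ffun {i | P i} -> K^o} := [ffun j => u (val j)].

Lemma ffun_restr_linear (K : fieldType) (I : finType) (P : pred I) :
  linear (@ffun_restr K I P).
Proof. by move=> a u v; apply/ffunP => j; rewrite !ffunE. Qed.

HB.instance Definition _ (K : fieldType) (I : finType) (P : pred I) :=
  GRing.isLinear.Build K {ffun I -> K^o} {ffun {i | P i} -> K^o} _
    (@ffun_restr K I P) (@ffun_restr_linear K I P).

(** Restriction to [P] is injective on the image and reaches every function on [P]. *)
Lemma dim_limg_ffun (K : fieldType) (E : vectType K) (I : finType) (P : pred I)
    (f : 'Hom(E, {ffun I -> K^o})) :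
  (forall v i, ~~ P i -> f v i = 0) ->
  (forall w : I -> K, exists v, forall i, P i -> f v i = w i) ->
  \dim (limg f) = #|P|.
Proof.
move=> f0 fs; pose p := linfun (@ffun_restr K I P).
have <- : \dim (p @: limg f) = \dim (limg f).
  apply: limg_dim_eq; apply/eqP; rewrite -subv0; apply/subvP => u.
  rewrite memv_cap memv_ker memv0 => /andP[/memv_imgP[v _ ->]].
  rewrite lfunE /= => /eqP/ffunP pu; apply/eqP/ffunP => i; rewrite [RHS]ffunE.
  have [Pi|nPi] := boolP (P i); last exact: f0.
  by have := pu (exist _ i Pi); rewrite !ffunE.
have -> : (p @: limg f)%VS = fullv.
  apply/vspaceP => w; rewrite memvf.
  have [v vE] := fs (fun i => if insub i is Some j then w j else 0).
  apply/memv_imgP; exists (f v); first exact/memv_img/memvf.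
  rewrite lfunE /=; apply/ffunP => j; rewrite ffunE vE ?valK //; exact: valP.
by rewrite dimvf /= /dim /= muln1 card_sig.
Qed.

Local Notation pi0_type e := {C : {set _} | C \in pi0 e}.

Lemma dim_H0 (T : finType) (e : rel T) : \dim {:H0 e} = #|pi0 e|.
Proof. by rewrite dimvf /= /dim /= muln1 card_sig. Qed.

Lemma pi0_sym_eq (T : finType) (e : rel T) (C C' : pi0_type e) x : symmetric e ->
  x \in val C -> x \in val C' -> C = C'.
Proof.
by move=> es xC xC'; apply: val_inj; rewrite (pi0_eq es xC) (pi0_eq es xC').
Qed.

Definition component (T : finType) (e : rel T) (x : T) : pi0_type e :=
  exist (fun C => C \in pi0 e) _
    (imset_f (fun x => [set y | connect e x y]%SET) (erefl (x \in T))).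

Lemma imset_sub_pi0 (T1 T2 : finType) (e1 : rel T1) (e2 : rel T2) (f : T1 -> T2)
    (C : pi0_type e1) (C' : pi0_type e2) x :
  symmetric e1 -> symmetric e2 -> {homo f : x y / e1 x y >-> e2 x y} ->
  x \in val C -> (f @: val C \subset val C')%SET = (f x \in val C').
Proof.
move=> s1 s2 fh xC; apply/idP/idP => [/fintype.subsetP|fxC'].
  by apply; apply: imset_f.
apply/fintype.subsetP => _ /imsetP[y yC ->].
rewrite (pi0_eq s2 fxC') inE; move: yC; rewrite (pi0_eq s1 xC) inE.
move=> /connectP[p pp ->]; apply/connectP; exists (map f p).
  by apply: homo_path pp => ? ?; apply: fh.
by rewrite last_map.
Qed.

Lemma rank_H0_map (T1 T2 : finType) (e1 : rel T1) (e2 : rel T2) (f : T1 -> T2) :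
  symmetric e1 -> symmetric e2 -> {homo f : x y / e1 x y >-> e2 x y} ->
  \dim (limg (H0_map e1 e2 f)) = #|[set C in pi0 e2 | [exists x, f x \in C]]%SET|.
Proof.
move=> s1 s2 fh; pose P (C : pi0_type e2) := [exists x, f x \in val C].
rewrite (@dim_limg_ffun _ _ _ P) => [|v C' nP|w].
- rewrite -(card_imset _ val_inj); apply: eq_card => C; rewrite !inE.
  apply/imsetP/andP => [[D PD ->]|[CP xC]]; first by split; [exact: valP|].
  by exists (exist _ C CP).
- rewrite H0_mapE ffunE big1 // => C sub; case/negP: nP; apply/existsP.
  have [x xC] := pi0_neq0 C; exists x.
  by move/fintype.subsetP: sub; apply; apply: imset_f.
(* [c] chooses one source component inside each component hit by [f]. Different targets get
   different choices, so putting [w C'] on the choice for [C'] realizes any prescribed values. *)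
pose c (C' : pi0_type e2) := omap (component e1) [pick x | f x \in val C'].
exists [ffun C => \sum_(C' | c C' == Some C) w C'] => C' /existsP[x0 x0C'].
rewrite H0_mapE ffunE; under eq_bigr do rewrite ffunE.
rewrite (exchange_big_dep predT) //=.
have cP D : P D -> exists2 x, f x \in val D & c D = Some (component e1 x).
  rewrite /c => /existsP[x xD]; case: pickP => [y yD|/(_ x)]; first by exists y.
  by rewrite xD.
have x_comp x : x \in val (component e1 x) by rewrite inE connect0.
rewrite (bigD1 C') //= [X in _ + X]big1 ?addr0 => [|D DC'].
  have [|x xC' cC'] := cP C'; first by apply/existsP; exists x0.
  rewrite (big_pred1 (component e1 x)) // => C /=; rewrite cC'.
  rewrite (inj_eq Some_inj) eq_sym; case: eqP => [->|]; last by rewrite andbF.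
  by rewrite (imset_sub_pi0 _ s1 s2 fh (x_comp x)) xC'.
rewrite big1 // => C /andP[sub].
rewrite /c; case: pickP => //= x xD /eqP[CE]; move: sub; rewrite -CE.
rewrite (imset_sub_pi0 _ s1 s2 fh (x_comp x)) => xC'.
by rewrite (pi0_sym_eq s2 xD xC') eqxx in DC'.
Qed.

End RankH0.

(** * Dimension counts and finitely supported sums *)

Lemma vspace_ofE (K : fieldType) (E : vectType K) (A : set E) (W : {vspace E}) :
  (forall v, v \in W <-> A v) -> vspace_of A = W.
Proof.
move=> WA; apply/vspaceP => v; rewrite /vspace_of.
pose S := [set W : {vspace E} | forall v, v \in W <-> A v]%classic.
have /(_ v) [inA Ain] : S (xget 0%VS S) by apply: xgetPex; exists W.
by apply/idP/idP => [/inA /WA|/WA /Ain].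
Qed.

(** The two summands meet in [A' :&: B'], so the dimension of the quotient is a mixed second
    difference of [\dim (A :&: B)], ready to telescope in [A]. *)
Lemma dim_flag_quotient (K : fieldType) (E : vectType K) (A A' B B' : {vspace E}) :
  (A' <= A)%VS -> (B' <= B)%VS ->
  (\dim (A :&: B) - \dim (A' :&: B + A :&: B'))%N%:Z =
  (\dim (A :&: B))%:Z - (\dim (A :&: B'))%:Z -
  ((\dim (A' :&: B))%:Z - (\dim (A' :&: B'))%:Z).
Proof.
move=> AA BB; have := dimv_sum_cap (A' :&: B) (A :&: B').
have -> : (A' :&: B :&: (A :&: B') = A' :&: B')%VS.
  by rewrite capvA -(capvA A') (capvC B) capvA (capv_idPl AA) -capvA (capv_idPr BB).
have : (\dim (A' :&: B + A :&: B') <= \dim (A :&: B))%N.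
  by rewrite dimvS // subv_add !capvS.
by move=> le e; rewrite -subzn //; move/(congr1 Posz): e; rewrite !PoszD; lia.
Qed.

Lemma pi0_connected (T : finType) (e : rel T) : T ->
  (forall x y, connect e x y) -> pi0 e = [set [set: T]]%SET.
Proof.
move=> x0 ec; apply/setP => C; rewrite inE; apply/imsetP/eqP => [[x _ ->]|->].
  by apply/setP => y; rewrite !inE ec.
by exists x0 => //; apply/setP => y; rewrite !inE ec.
Qed.

Lemma fsum_finsupp (R : realType) (m : {fsfun R -> nat with 0%N}) (r : R) :
  (\sum_(b <- finsupp m | (r < b)%R) m b)%N%:Z =
  \sum_(b \in [set b : R | r < b]%classic) (m b)%:Z.
Proof.
rewrite (fsbigE [seq b <- finsupp m | r < b]) ?filter_uniq ?fset_uniq //=.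
- rewrite big_filter_cond (big_morph Posz PoszD erefl); apply: eq_bigl => b.
  by rewrite mem_setE andbb.
- by move=> b /=; rewrite mem_filter => /andP[].
by move=> b rb; rewrite mem_filter rb /= => bm; rewrite fsfun_dflt.
Qed.

(** This reads the multiplicity at [b] off two bar counts: the bars ending after [p] but not after
    [b] all end at [b]. *)
Lemma sum_finsupp_gt (R : realType) (m : {fsfun R -> nat with 0%N}) (p b : R) :
  p < b -> (forall d, d \in finsupp m -> p < d -> b <= d) ->
  (\sum_(d <- finsupp m | (p < d)%R) m d =
   m b + \sum_(d <- finsupp m | (b < d)%R) m d)%N.
Proof.
move=> pb mb.
have -> : m b = (\sum_(d <- finsupp m | d == b) m d)%N.
  have [bm|bm] := boolP (b \in finsupp m).
    rewrite (big_rem b) //= eqxx big_seq_cond big1 ?addn0 // => d.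
    rewrite mem_rem_uniq ?fset_uniq // inE andbC /= => /and3P[/eqP ->].
    by rewrite eqxx.
  rewrite fsfun_dflt // big_seq_cond big1 // => d /andP[dm /eqP db].
  by rewrite -db dm in bm.
rewrite big_mkcond [in RHS]big_mkcond [X in (_ + X)%N]big_mkcond -big_split /=.
rewrite big_seq [RHS]big_seq; apply: eq_bigr => d dm.
case: eqP => [->|/eqP db]; first by rewrite pb ltxx addn0.
rewrite add0n; congr (if _ then _ else _); apply/idP/idP => [/(mb d dm)|].
  by rewrite lt_neqAle eq_sym db.
exact: lt_trans.
Qed.

(** * Rips graphs at varying scale; components meeting or missing [X] *)

Section MatchingDiagram.
Variables (R : realType) (M : metricType R).
Implicit Types A X Z : {fset M}.

Definition dists Z : seq R :=
  undup [seq mdist x y | x <- enum_fset Z, y <- enum_fset Z].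

Lemma dists_uniq Z : uniq (dists Z). Proof. exact: undup_uniq. Qed.

Lemma mem_dists Z x y : x \in Z -> y \in Z -> mdist x y \in dists Z.
Proof.
move=> xZ yZ; rewrite mem_undup; apply/allpairsP.
by exists (x, y).
Qed.

(** Stated for the relation itself: by [step_on_comp], whatever is computed from the graph is then a
    step function too. *)
Lemma step_VR A Z : (A `<=` Z)%fset -> step_on (dists Z) (@VR R M A).
Proof.
move=> /fsubsetP AZ r s r0 rs gap; apply/funext => x; apply/funext => y.
rewrite /VR; congr andb; apply/idP/idP => [/le_trans->//|ys].
rewrite leNgt; apply/negP => /(gap _ (mem_dists (AZ _ (valP x)) (AZ _ (valP y)))).
by rewrite ltNge ys.
Qed.

Lemma step_on_comp (D : seq R) T T' (h : T -> T') (g : R -> T) :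
  step_on D g -> step_on D (h \o g).
Proof. by move=> gD r s r0 rs gap /=; rewrite (gD r s). Qed.

Lemma pi0_VR_max A (t : R) : A != fset0 ->
  (forall x y : A, mdist (val x) (val y) <= t) ->
  pi0 (@VR R M A t) = [set [set: A]]%SET.
Proof.
move=> /fset0Pn[x xA] At; apply: pi0_connected [` xA]%fset _ => y z.
have [->|yz] := eqVneq y z; first exact: connect0.
by apply: connect1; rewrite /VR yz At.
Qed.

Definition meeting X Z (XZ : (X `<=` Z)%fset) (r : R) :=
  [set C in pi0 (@VR R M Z r) | [exists x : X, fincl XZ x \in C]]%SET.

Definition missing X Z (r : R) :=
  [set C in pi0 (@VR R M Z r) | [forall x in C, val x \notin X]]%SET.

Lemma existsN_missing X Z (XZ : (X `<=` Z)%fset) (C : {set Z}) :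
  ~~ [exists x : X, fincl XZ x \in C] = [forall x in C, val x \notin X].
Proof.
rewrite negb_exists; apply/forallP/forall_inP => [nC x xC|nC x]; apply/negP => xX.
  have /negP := nC [` xX]%fset; apply.
  by rewrite (_ : fincl _ _ = x) //; exact: val_inj.
by have /negP := nC _ xX; apply; rewrite /= fsvalP.
Qed.

Lemma card_meeting_missing X Z (XZ : (X `<=` Z)%fset) r :
  #|pi0 (@VR R M Z r)| = (#|meeting XZ r| + #|missing X Z r|)%N.
Proof.
rewrite -(cardsID [set C : {set Z} | [exists x : X, fincl XZ x \in C]]%SET).
congr addn; apply: eq_card => C; rewrite !inE // andbC.
by rewrite existsN_missing.
Qed.

Lemma fincl_homo X Z (XZ : (X `<=` Z)%fset) (r s : R) : r <= s ->
  {homo fincl XZ : x y / VR r x y >-> VR s x y}.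
Proof.
move=> rs x y /andP[xy d]; rewrite /VR (le_trans d rs) andbT.
by apply: contra xy => /eqP[xy]; apply/eqP/val_inj.
Qed.

Lemma dim_PH0 A (r : R) : \dim {:PH0 A r} = #|pi0 (@VR R M A r)|.
Proof. exact: dim_H0. Qed.

(** Every component contains a vertex, so by [rank_H0_map] the map out of scale 0 has full rank. *)
Lemma generated_PH0 A : generated_at_0 (PH0 A).
Proof.
move=> r r0; apply/eqP; rewrite eqEdim subvf dim_PH0 /=.
rewrite (rank_H0_map (@VR_sym _ _ _ _) (@VR_sym _ _ _ _) (VR_homo r0)).
apply/subset_leq_card/fintype.subsetP => C Cpi; rewrite inE Cpi /=.
by case/imsetP: Cpi => x _ ->; apply/existsP; exists x; rewrite inE connect0.
Qed.

Lemma dim_ker_plus A (r : R) : 0 <= r ->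
  (\dim (ker_plus (PH0 A) r) + #|pi0 (@VR R M A r)|)%N = \dim {:PH0 A 0%R}.
Proof.
move=> r0; rewrite -dim_PH0 -(generated_PH0 A r0).
by rewrite -[RHS](limg_ker_dim (pm_map (PH0 A) 0 r) fullv) capfv.
Qed.

Lemma step_ker_plus A Z : (A `<=` Z)%fset ->
  step_on (dists Z) (ker_plus (PH0 A)).
Proof.
(* The target space varies with the scale, but the kernel stays in the fixed space at scale 0. *)
move=> AZ; exact: (step_on_comp
  (fun e => lker (H0_map (@VR R M A 0) e id)) (step_VR AZ)).
Qed.

(** The kernels increase and change only at distances, so the union over [r < b] is attained at
    [below (dists Z) b]. *)
Lemma ker_minusE A Z (b : R) : (A `<=` Z)%fset -> 0 < b ->
  ker_minus (PH0 A) b = ker_plus (PH0 A) (below (dists Z) b).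
Proof.
move=> AZ b0; apply: vspace_ofE => v; split=> [vb|[r /= /andP[r0 rb] vr]].
  by exists (below (dists Z) b) => //=; rewrite below_ge0 below_lt.
have [rbel|belr] := leP r (below (dists Z) b).
  exact: (subvP (lker_pm_map (PH0 A) r0 rbel)).
by rewrite (step_on_below (step_ker_plus AZ) (ltW belr) rb).
Qed.

(** * Multiplicities and block sums as jumps of component counts *)

Section Pair.
Variables (X Z : {fset M}) (XZ : (X `<=` Z)%fset) (X_neq0 : X != fset0).
Local Notation D := (dists Z).

Lemma Z_neq0 : Z != fset0.
Proof. by apply: contraNneq X_neq0 => Z0; rewrite -fsubset0 -Z0. Qed.

Lemma far_pi0 A (t : R) : (A `<=` Z)%fset -> A != fset0 ->
  (forall d, d \in D -> d <= t) -> pi0 (@VR R M A t) = [set [set: A]]%SET.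
Proof.
move=> /fsubsetP AZ A0 Dt; apply: pi0_VR_max => // x y.
by apply/Dt/mem_dists/AZ/valP/AZ/valP.
Qed.

Lemma far_missing (t : R) : (forall d, d \in D -> d <= t) -> #|missing X Z t| = 0%N.
Proof.
move=> Dt; apply/eqP; rewrite cards_eq0; apply/eqP/setP => C; rewrite !inE.
rewrite far_pi0 ?fsubset_refl ?Z_neq0 // inE; case: eqP => //= ->.
have /fset0Pn[x xX] := X_neq0; apply/negbTE/negP => /forall_inP nX.
by have := nX [` fsubsetP XZ _ xX]%fset (finset.in_setT _); rewrite /= xX.
Qed.

Lemma far_meeting (t : R) : (forall d, d \in D -> d <= t) -> #|meeting XZ t| = 1%N.
Proof.
move=> Dt; have := card_meeting_missing XZ t.
by rewrite far_missing // addn0 far_pi0 ?fsubset_refl ?Z_neq0 // cards1.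
Qed.

Lemma exists_far (b : R) : exists t : R,
  [/\ 0 <= t, b <= t & forall d, d \in D -> d <= t].
Proof.
exists (Num.max b (\big[Num.max/0]_(d <- D) d)); split.
- rewrite le_max orbC; apply/orP; left.
  by elim/big_rec: _ => // d x _ x0; rewrite le_max x0 orbT.
- by rewrite le_max lexx.
- by move=> d dD; rewrite le_max orbC le_bigmax_seq.
Qed.

(** The jumps of the component count form a barcode by [pm_iso_generated]. Conversely the dimensions
    determine any barcode, in particular the one picked by [multiplicity]. *)
Lemma multiplicity_PH0 (b : R) : 0 < b ->
  (multiplicity (PH0 Z) b)%:Z =
  #|pi0 (@VR R M Z (below D b))|%:Z - #|pi0 (@VR R M Z b)|%:Z.
Proof.
pose c (r : R) := #|pi0 (@VR R M Z r)|.
have stepc T (h : nat -> T) : step_on D (h \o c).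
  exact: (step_on_comp (fun e => h #|pi0 e|) (step_VR (fsubset_refl Z))).
have cdec (b' : R) : 0 < b' -> (c b' <= c (below D b'))%N.
  move=> b0; have := dim_ker_plus Z (below_ge0 D b').
  rewrite -(dim_ker_plus Z (ltW b0)) -/(c _) -/(c b') => e.
  have le : (\dim (ker_plus (PH0 Z) (below D b')) <= \dim (ker_plus (PH0 Z) b'))%N.
    by apply/dimvS/lker_pm_map/ltW/below_lt => //; apply: below_ge0.
  by rewrite -(leq_add2l (\dim (ker_plus (PH0 Z) (below D b')))) e leq_add2r.
have barE m : is_barcode (PH0 Z) m -> forall r : R, 0 <= r ->
    c r = (\sum_(d <- finsupp m | (r < d)%R) m d + 1)%N.
  by move=> [_ mP] r r0; rewrite /c -dim_PH0 (pm_iso_dim mP r0) -dim_barcode.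
have [m mP] : exists m, is_barcode (PH0 Z) m.
  (* The truncated subtraction is exact by [cdec]. The jumps after [r] add up to [c r - 1], and the
     infinite bar supplies the missing 1. *)
  pose m := [fsfun d in [fset d in D | 0 < d]%fset => (c (below D d) - c d)%N | 0%N].
  have m0 d : d \in finsupp m -> 0 < d.
    rewrite mem_finsupp fsfunE; case: ifP; rewrite ?eqxx // !inE /=.
    by case/andP.
  exists m; split=> //.
  apply: (pm_iso_generated (generated_PH0 Z) (generated_barcode m)) => r r0.
  rewrite dim_barcode dim_PH0; apply/eqP; rewrite -eqz_nat PoszD fsum_finsupp.
  have [t [t0 _ Dt]] := exists_far 0.
  rewrite (fsum_step (dists_uniq Z) (stepc _ Posz) r0 t0 Dt) => [|d d0] /=.
    by rewrite /c (far_pi0 _ _ Dt) ?fsubset_refl ?Z_neq0 // cards1 subrK.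
  rewrite fsfunE !inE /= d0 andbT; case: ifPn => [_|dD]; first by rewrite subzn ?cdec.
  by have /= -> := step_on_belowN (stepc _ id) d0 dD; rewrite subrr.
have {mP}: is_barcode (PH0 Z) (multiplicity (PH0 Z)).
  by apply: (@xgetPex _ [fsfun]); exists m.
move: (multiplicity _) => {}m /barE mE b0.
(* The support of this barcode is not known to lie in [D], so [p] must be past every earlier point
   of both. *)
pose p := below (D ++ finsupp m) b.
have pb : p < b by apply: below_lt.
have -> : #|pi0 (@VR R M Z (below D b))| = c p.
  apply: (step_on_below (stepc _ id) _ pb); rewrite /below big_seq_cond.
  apply: bigmax_le => [|d /andP[dD db]]; first exact: below_ge0.
  by apply: le_below db; rewrite mem_cat dD.
rewrite -/(c b) (mE p) ?below_ge0 // (mE b (ltW b0)) (@sum_finsupp_gt _ m p b pb).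
  by rewrite !PoszD; lia.
move=> d dm; apply: contraTT; rewrite -ltNge -leNgt => db.
by apply: le_below db; rewrite mem_cat dm orbT.
Qed.

Let incl := H0_incl XZ.

Lemma incl_comp (r : R) : 0 <= r ->
  (pm_map (PH0 Z) 0 r \o incl)%VF = H0_map (@VR R M X 0) (@VR R M Z r) (fincl XZ).
Proof.
move=> r0; apply: H0_map_comp; [exact: VR_sym|exact: VR_sym| |].
  exact: fincl_homo.
exact: VR_homo.
Qed.

Lemma rank_incl_comp (r : R) : 0 <= r ->
  \dim (limg (pm_map (PH0 Z) 0 r \o incl)) = #|meeting XZ r|.
Proof.
move=> r0; rewrite incl_comp //; apply: rank_H0_map; [exact: VR_sym|exact: VR_sym|].
exact: fincl_homo.
Qed.

(** Rank-nullity for the map from the image of [incl] to scale [r]. *)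
Lemma dim_limg_incl_cap (r : R) : 0 <= r ->
  (\dim (limg incl :&: ker_plus (PH0 Z) r) + #|meeting XZ r|)%N = \dim (limg incl).
Proof.
by move=> r0; rewrite -rank_incl_comp // limg_comp; apply: limg_ker_dim.
Qed.

(** One inclusion is functoriality. Both kernels have codimension 1, since at scale [t] all points
    are connected. *)
Lemma far_ker_plus (t : R) : 0 <= t -> (forall d, d \in D -> d <= t) ->
  ker_plus (PH0 X) t = lker (pm_map (PH0 Z) 0 t \o incl)%VF.
Proof.
move=> t0 Dt; apply/eqP; rewrite eqEdim; apply/andP; split.
  apply/subvP => v vt; rewrite memv_ker incl_comp //.
  have -> : H0_map (@VR R M X 0) (@VR R M Z t) (fincl XZ) =
      (H0_map (@VR R M X t) (@VR R M Z t) (fincl XZ) \o pm_map (PH0 X) 0 t)%VF.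
    apply/esym/H0_map_comp; [exact: VR_sym|exact: VR_sym|exact: VR_homo|].
    exact: fincl_homo.
  by rewrite comp_lfunE; move: vt; rewrite memv_ker => /eqP ->; rewrite linear0.
have dimL : (\dim (lker (pm_map (PH0 Z) 0 t \o incl)%VF) + #|meeting XZ t|)%N =
    \dim {:PH0 X 0%R}.
  rewrite -rank_incl_comp //.
  by rewrite -[RHS](limg_ker_dim (pm_map (PH0 Z) 0 t \o incl)%VF fullv) capfv.
have dimK := dim_ker_plus X t0.
have cardX : #|pi0 (@VR R M X t)| = #|meeting XZ t|.
  by rewrite (far_pi0 XZ X_neq0 Dt) cards1 far_meeting.
apply/eq_leq/(@addIn #|meeting XZ t|); apply: etrans dimL _.
by rewrite -cardX; apply: esym dimK.
Qed.

Lemma sum_block_function (b : R) : 0 < b ->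
  \sum_(a \in [set a : R | 0 < a]%classic) (block_function XZ a b)%:Z =
  #|meeting XZ (below D b)|%:Z - #|meeting XZ b|%:Z.
Proof.
move=> b0; have [t [t0 bt Dt]] := exists_far b.
pose A (a : R) := (incl @: ker_plus (PH0 X) a)%VS.
pose B (r : R) := ker_plus (PH0 Z) r.
have bb0 := below_ge0 D b; have bbt := le_trans (ltW (below_lt D b0)) bt.
have BB : (B (below D b) <= B b)%VS by apply/lker_pm_map/ltW/below_lt.
(* Signed so that, by [dim_flag_quotient], the block function at [a] is the drop
   [g (below D a) - g a]. *)
pose g (a : R) := (\dim (A a :&: B (below D b)))%:Z - (\dim (A a :&: B b))%:Z.
have gD : step_on D g.
  exact: (step_on_comp (fun W => (\dim (incl @: W :&: B (below D b)))%:Z -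
    (\dim (incl @: W :&: B b))%:Z) (step_ker_plus XZ)).
rewrite (fsum_step (dists_uniq Z) gD (lexx 0) t0 Dt) => [|a a0]; last first.
  rewrite /block_function (ker_minusE XZ a0) (ker_minusE (fsubset_refl Z) b0).
  have AA : (A (below D a) <= A a)%VS.
    by apply/limgS/lker_pm_map/ltW/below_lt; rewrite ?below_ge0.
  apply: etrans (dim_flag_quotient AA BB) _.
  have alt (x y z u : int) : x - y - (z - u) = u - z - (y - x) by lia.
  rewrite /g; exact: alt.
have -> : g 0 = 0.
  have A0 : A 0 = 0%VS.
    rewrite /A (_ : ker_plus _ _ = 0%VS) ?limg0 //; apply/eqP/lker0P.
    by rewrite pm_map_id // => u v; rewrite !id_lfunE.
  by rewrite /g A0 !cap0v subrr.
(* A class of [X] that dies in [PH0 Z] by scale [r] is also dead there at [t], hence lies in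
   [ker_plus (PH0 X) t] by [far_ker_plus]. *)
have gt (r : R) : 0 <= r -> r <= t -> (A t :&: B r = limg incl :&: B r)%VS.
  move=> r0 rt; apply/vspaceP => u; rewrite !memv_cap; apply/andP/andP.
    by case=> At Br; split=> //; apply: (subvP (limgS _ (subvf _))) At.
  case=> /memv_imgP[v _ uE] Br; split=> //; rewrite uE memv_img // far_ker_plus //.
  rewrite memv_ker comp_lfunE -uE.
  by have := subvP (lker_pm_map (PH0 Z) r0 rt) u Br; rewrite memv_ker.
rewrite /g !gt //; last exact: ltW.
have := dim_limg_incl_cap bb0; rewrite -(dim_limg_incl_cap (ltW b0)) -!/(B _).
by move=> /(congr1 Posz); rewrite !PoszD; lia.
Qed.

Lemma step_missing : step_on D (fun r => #|missing X Z r|%:Z).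
Proof.
exact: (step_on_comp
  (fun e => #|[set C in pi0 e | [forall x in C, val x \notin X]]%SET|%:Z)
  (step_VR (fsubset_refl Z))).
Qed.

Lemma mD_inftyE (b : R) : 0 < b ->
  mD_infty XZ b = #|missing X Z (below D b)|%:Z - #|missing X Z b|%:Z.
Proof.
move=> b0; rewrite /mD_infty multiplicity_PH0 // sum_block_function //.
by rewrite !(card_meeting_missing XZ) !PoszD; lia.
Qed.

Lemma sum_mD_infty (r : R) : 0 <= r ->
  #|missing X Z r|%:Z = \sum_(b \in [set b : R | r < b]%classic) mD_infty XZ b.
Proof.
move=> r0; have [t [t0 _ Dt]] := exists_far 0.
rewrite (fsum_step (dists_uniq Z) step_missing r0 t0 Dt mD_inftyE) (far_missing Dt).
exact: esym (subr0 _).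
Qed.

(** Positive values of [mD_infty] occur only in the finite list [D], so the maximum exists and
    [xget] returns it. *)
Lemma eta_fP : 0 <= eta_f XZ /\
  forall b : R, 0 < b -> 0 < mD_infty XZ b -> b <= eta_f XZ.
Proof.
pose S := [set b : R | 0 <= b /\ (b = 0 \/ 0 < b /\ 0 < mD_infty XZ b)]%classic.
have [[]] : (S `&` ubound S)%classic (eta_f XZ).
  apply: (@xgetPex _ 0 (S `&` ubound S)%classic).
  exists (\big[Num.max/0]_(b <- D | `[< S b >]) b); split.
    elim/big_rec: _ => [|b x /asboolP Sb Sx]; first by split=> //; left.
    by rewrite maxEle; case: ifP.
  move=> b Sb; case: (Sb) => _ [->|[b0 mb]].
    by elim/big_rec: _ => // d x _ x0; rewrite le_max x0 orbT.
  apply: le_bigmax_seq; last exact/asboolP.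
  apply: contraLR mb => bD; rewrite mD_inftyE //.
  by rewrite (step_on_belowN step_missing b0 bD) subrr ltxx.
move=> eta0 _ ubS; split=> // b b0 mb; apply: ubS.
by split; [exact: ltW|right].
Qed.

End Pair.
End MatchingDiagram.

Theorem proposition3p3 (R : realType) (M : metricType R) (Z X : {fset M})
    (X_neq0 : X != fset0) (XZ : (X `<=` Z)%fset) :
  [/\ forall r : R, 0 <= r ->
        (#|[set C in pi0 (@VR R M Z r) | [forall x in C, val x \notin X]]%SET|)%:Z
        = \sum_(b \in [set b : R | r < b]%classic) mD_infty XZ b,
      forall r : R, eta_f XZ <= r ->
        forall C, C \in pi0 (@VR R M Z r) -> exists2 x, x \in C & val x \in X
    & eta_f XZ = 0 -> X = Z].
Proof.
have sumE := sum_mD_infty XZ X_neq0; have [eta0 etaP] := eta_fP XZ X_neq0.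
have meets (r : R) : eta_f XZ <= r ->
    forall C, C \in pi0 (@VR R M Z r) -> exists2 x, x \in C & val x \in X.
  move=> etar C Cpi; have : #|missing X Z r|%:Z <= 0.
    (* Beyond [eta_f] no term is positive, which forces the count to be 0. *)
    rewrite sumE ?(le_trans eta0) //; apply: fsumr_le0 => b rb.
    rewrite leNgt; apply/negP => /etaP.
    rewrite leNgt (le_lt_trans etar rb).
    by move=> /(_ (le_lt_trans (le_trans eta0 etar) rb)).
  rewrite lez_nat leqn0 cards_eq0 => /eqP/setP/(_ C); rewrite !inE Cpi /=.
  move/negbT; rewrite negb_forall => /existsP[x].
  by rewrite negb_imply negbK => /andP[xC xX]; exists x.
split=> // eta0E; apply/fsetP => z; apply/idP/idP => [/(fsubsetP XZ)//|zZ].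
(* The component of [z] at scale 0 meets [X]; distinct points have positive distance, so that
   component is just [z]. *)
have [||x xz xX] := meets 0 _ [set y | connect (@VR R M Z 0) [` zZ]%fset y]%SET.
- by rewrite eta0E.
- exact: imset_f.
move: xz; rewrite inE => /connectP[[|y p] /=].
  by move=> _ xE; rewrite xE in xX.
rewrite /VR => /andP[/andP[zy]].
by rewrite leNgt mdist_gt0 => /negP[]; apply: contra zy => /eqP/val_inj ->.
Qed.
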